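(* Let $F$ and $G$ be real Hilbert spaces, let $\Lambda : F \to \mathbb{R}^m$ be a bounded linear map, let $V$ be a linear subspace of $F$ with $V \cap \ker(\Lambda) = \{0\}$, let $\varepsilon, \eta > 0$, and let $\Gamma : F \to G$ be a bounded linear map (quantity of interest). Consider the model set $\{ f \in F : \|P_{V^\perp} f\| \le \varepsilon \}$ and the uncertainty set $\{ e \in \ell_2^m : \|e\| \le \eta \}$. If $\Lambda \Lambda^* = \mathrm{Id}_{\mathbb{R}^m}$, then, when $\mathrm{range}(\Gamma^* ) \subseteq \ker(\Lambda)$ or when $\Gamma = \mathrm{Id}$ (with $G = F$), one has $$ \mathrm{gwce}(\Gamma \circ \Delta^\sigma) = \inf_{\Delta} \mathrm{gwce}(\Delta) \qquad \text{for all } \sigma \in (0,1), $$ where the infimum is taken over all maps $\Delta : \mathbb{R}^m \to G$; i.e., all regularization maps $\Delta^\sigma$, when composed with $\Gamma$, produce globally optimal recovery maps.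
   Context: $P_{V^\perp}$ denotes the orthogonal projector of $F$ onto the orthogonal complement $V^\perp$ of $V$, and $\mathbb{R}^m$ carries the Euclidean norm ($\ell_2^m$). For an arbitrary (not necessarily linear) map $\Delta : \mathbb{R}^m \to G$, the global worst-case error for the recovery of $\Gamma$ is $$ \mathrm{gwce}(\Delta) := \sup \big\{ \|\Gamma(f) - \Delta(\Lambda f + e)\| : \ f \in F,\ \|P_{V^\perp} f\| \le \varepsilon, \ e \in \mathbb{R}^m, \ \|e\| \le \eta \big\}. $$ For $\sigma \in (0,1)$, the regularization map $\Delta^\sigma : \mathbb{R}^m \to F$ is defined by $$ \Delta^\sigma(y) := \underset{f \in F}{\mathrm{argmin}} \ \frac{1-\sigma}{\varepsilon^2} \|P_{V^\perp} f\|^2 + \frac{\sigma}{\eta^2} \|y - \Lambda f\|^2 , $$ the minimizer being unique because $V \cap \ker(\Lambda) = \{0\}$.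
   Formalization: For Γ = Id the formal theorem additionally assumes V ≠ {0} when m > 0, and ker(Λ) ≠ {0} when V ≠ F; without these the claim is false (e.g. F = R, Λ = Id, V = {0}, ε = 1, η = 2, σ = 1/2). *)

(* Defs.v *)
From HB Require Import structures.
From mathcomp Require Import all_boot all_order all_algebra.
From mathcomp Require Import sesquilinear.
From mathcomp Require Import all_classical all_reals all_analysis.
From mathcomp Require Import ring lra zify.

Set Implicit Arguments.
Unset Strict Implicit.
Unset Printing Implicit Defensive.

Import Order.TTheory GRing.Theory Num.Theory.
Import numFieldNormedType.Exports.

Local Open Scope classical_set_scope.
Local Open Scope ring_scope.

HB.mixin Record isHilbert (R : realType) H & CompleteNormedModule R H := {
  inner : {dot H for (@idfun R)};
  sqr_normE : forall x : H, `|x| ^+ 2 = inner x x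
}.

#[short(type="hilbertType")]
HB.structure Definition Hilbert (R : realType) :=
  {H of CompleteNormedModule R H & isHilbert R H}.

(* Row vectors of size [m] with the Euclidean norm.  A separate type is needed
   because ['rV[R]_m] itself canonically carries the maximum norm. *)
Definition euclidean (R : realType) (m : nat) : Type := 'rV[R]_m.

Section euclidean.
Context {R : realType} {m : nat}.
Local Notation E := (euclidean R m).

HB.instance Definition _ := GRing.Lmodule.on E.

Definition dotv (x y : E) : R := \sum_i x 0 i * y 0 i.
Definition l2norm (x : E) : R := Num.sqrt (dotv x x).

Lemma dotv_ge0 (x : E) : 0 <= dotv x x.
Proof. by apply: sumr_ge0 => i _; rewrite -expr2 sqr_ge0. Qed.

Lemma dotv_eq0 (x : E) : dotv x x = 0 -> x = 0.
Proof.
move=> /eqP; rewrite /dotv psumr_eq0 => [|i _]; last by rewrite -expr2 sqr_ge0.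
move=> /allP x0; apply/rowP => i; rewrite mxE.
by have := x0 i (mem_index_enum _); rewrite /= mulf_eq0 orbb => /eqP.
Qed.

Lemma sqr_l2norm (x : E) : l2norm x ^+ 2 = dotv x x.
Proof. by rewrite sqr_sqrtr ?dotv_ge0. Qed.

Lemma dotvC (x y : E) : dotv x y = dotv y x.
Proof. by apply: eq_bigr => i _; rewrite mulrC. Qed.

Lemma dotv_linear (y : E) (a : R) (u v : E) :
  dotv (a *: u + v) y = a * dotv u y + dotv v y.
Proof.
rewrite /dotv mulr_sumr -big_split; apply: eq_bigr => i _ /=.
by rewrite !mxE mulrDl mulrA.
Qed.

Lemma dotv_bilinear : bilinear_for *%R (@idfun R \; *%R) dotv.
Proof.
split=> u a v w; first exact: dotv_linear.
by rewrite !(dotvC u) dotv_linear.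
Qed.

HB.instance Definition _ := @bilinear_isBilinear.Build R E E R
  *%R (@idfun R \; *%R) dotv dotv_bilinear.

Lemma dotv_hermitian (x y : E) : dotv x y = (-1) ^+ false * idfun (dotv y x).
Proof. by rewrite mul1r dotvC. Qed.

HB.instance Definition _ := @isHermitianSesquilinear.Build R E false
  (@idfun R) dotv dotv_hermitian.

Lemma dotv_gt0 (x : E) : x != 0 -> 0 < dotv x x.
Proof.
by move=> x0; rewrite lt0r dotv_ge0 andbT; apply: contra_neq x0; exact: dotv_eq0.
Qed.

HB.instance Definition _ := @isDotProduct.Build R E dotv dotv_gt0.

Lemma dotv_lincomb (a b : R) (x y : E) :
  dotv (a *: x + b *: y) (a *: x + b *: y) =
  a ^+ 2 * dotv x x + 2 * a * b * dotv x y + b ^+ 2 * dotv y y.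
Proof.
rewrite /dotv !mulr_sumr -!big_split; apply: eq_bigr => i _ /=.
by rewrite !mxE; ring.
Qed.

Lemma dotv_CauchySchwarz (x y : E) : dotv x y <= l2norm x * l2norm y.
Proof.
set a := dotv x x; set b := dotv x y; set c := dotv y y.
have key : 0 <= c * (a * c - b ^+ 2).
  rewrite [leRHS](_ : _ = c ^+ 2 * a + 2 * c * (- b) * b + (- b) ^+ 2 * c).
    by rewrite -dotv_lincomb dotv_ge0.
  by ring.
have [c0|c_neq0] := eqVneq c 0.
  rewrite /b (dotv_eq0 c0) /dotv big1 => [|i _]; last by rewrite mxE mulr0.
  by rewrite mulr_ge0 ?sqrtr_ge0.
have c_gt0 : 0 < c by rewrite lt0r c_neq0 dotv_ge0.
rewrite /l2norm -sqrtrM ?dotv_ge0// (le_trans (ler_norm _))// -sqrtr_sqr.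
by rewrite ler_sqrt ?mulr_ge0 ?dotv_ge0// -subr_ge0 -(pmulr_rge0 _ c_gt0).
Qed.

Lemma l2normD (x y : E) : l2norm (x + y) <= l2norm x + l2norm y.
Proof.
rewrite -ler_sqr ?nnegrE ?addr_ge0 ?sqrtr_ge0// sqrrD !sqr_l2norm.
rewrite -[x in x + y]scale1r -[y in _ + y]scale1r dotv_lincomb.
have := dotv_CauchySchwarz x y; lra.
Qed.

Lemma l2normZ (a : R) (x : E) : l2norm (a *: x) = `|a| * l2norm x.
Proof.
rewrite /l2norm -sqrtr_sqr -sqrtrM ?sqr_ge0//; congr Num.sqrt.
by rewrite /dotv mulr_sumr; apply: eq_bigr => i _; rewrite !mxE; ring.
Qed.

Lemma l2norm_eq0 (x : E) : l2norm x = 0 -> x = 0.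
Proof. by move=> x0; apply: dotv_eq0; rewrite -sqr_l2norm x0 expr0n. Qed.

HB.instance Definition _ :=
  @Lmodule_isNormed.Build R E l2norm l2normD l2normZ l2norm_eq0.

Lemma euclidean_coord_le (x : E) i : `|x 0 i| <= `|x|.
Proof.
rewrite [leRHS]/(l2norm x) -sqrtr_sqr ler_sqrt ?dotv_ge0// /dotv (bigD1 i)//=.
by rewrite -expr2 lerDl sumr_ge0// => j _; rewrite -expr2 sqr_ge0.
Qed.

Lemma euclidean_le_coord (x : E) (d : R) :
  0 <= d -> (forall i, `|x 0 i| <= d) -> `|x| <= m.+1%:R * d.
Proof.
move=> d0 xd; rewrite [leLHS]/(l2norm x).
rewrite -ler_sqr ?nnegrE ?sqrtr_ge0 ?mulr_ge0// sqr_l2norm.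
apply: (@le_trans _ _ (\sum_(i < m) d ^+ 2)).
  by apply: ler_sum => i _; rewrite -expr2 -real_normK ?num_real// ler_sqr ?nnegrE.
rewrite sumr_const card_ord -[leLHS]mulr_natl exprMn ler_wpM2r ?sqr_ge0//.
by rewrite -natrX ler_nat expnS expn1; nia.
Qed.

Lemma euclidean_complete (F : set_system E) :
  ProperFilter F -> cauchy F -> cvg F.
Proof.
move=> FF /cauchy_ballP Fc.
have cvF i : cvg ((fun x : E => x 0 i) @ F).
  apply: R_complete; apply/cauchy_ballP => e e0.
  rewrite near_map2; apply: filterS (Fc e e0).
  move=> [x y] /=; rewrite -!ball_normE /ball_ /=.
  by apply: le_lt_trans; have := euclidean_coord_le (x - y) i; rewrite !mxE.
pose l : E := \row_i lim ((fun x : E => x 0 i) @ F).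
apply/cvg_ex; exists l; apply/cvgrPdist_le => e e0.
have d0 : 0 < e / m.+1%:R by rewrite divr_gt0.
have : \forall x \near F, forall i : 'I_m, `|l 0 i - (x : E) 0 i| <= e / m.+1%:R.
  apply: filter_forall => i; rewrite mxE.
  by have /cvgrPdist_le := cvF i; apply.
apply: filterS => x xl; rewrite [leRHS](_ : _ = m.+1%:R * (e / m.+1%:R)); last by field.
apply: euclidean_le_coord => [|i]; first exact: ltW.
by have := xl i; rewrite !mxE.
Qed.

HB.instance Definition _ := Uniform_isComplete.Build E euclidean_complete.

HB.instance Definition _ := @isHilbert.Build R E dotv sqr_l2norm.

End euclidean.

Section hilbert.
Context {R : realType}.
Implicit Types H K : hilbertType R.

Definition orthocompl H (V : set H) : set H :=
  [set w | forall v, V v -> inner w v = 0].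

(* The orthogonal projector onto [W]; [p] is unique, and it exists for every
   [f] as soon as [W] is a closed subspace. *)
Definition orthoproj H (W : set H) (f : H) : H :=
  xget 0 [set p | W p /\ orthocompl W (f - p)].

(* Existence, for a bounded linear [A], is the Riesz representation theorem. *)
Definition adjoint H K (A : H -> K) (y : K) : H :=
  xget 0 [set x | forall f, inner (A f) y = inner f x].

Definition argmin (T : Type) (J : T -> R) : set T :=
  [set x | forall z, J x <= J z].

End hilbert.

Section recovery.
Context {R : realType} {F G : hilbertType R} {m : nat}.
Variables (Lambda : F -> euclidean R m) (V : set F) (eps eta : R).

(* Valued in the extended reals: the supremum is infinite for a bad [Delta]. *)
Definition gwce (Gamma : F -> G) (Delta : euclidean R m -> G) : \bar R :=
  ereal_sup [set (`|Gamma fe.1 - Delta (Lambda fe.1 + fe.2)|)%:E |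
    fe in [set fe : F * euclidean R m |
      `|orthoproj (orthocompl V) fe.1| <= eps /\ `|fe.2| <= eta]].

Definition regularization (sigma : R) (y : euclidean R m) : F :=
  xget 0 (argmin (fun f : F =>
    (1 - sigma) / eps ^+ 2 * `|orthoproj (orthocompl V) f| ^+ 2
    + sigma / eta ^+ 2 * `|y - Lambda f| ^+ 2)).

End recovery.

(* Main.v *)
(* Any recovery map has worst-case error at least
   r = sup {|Gamma h| : |P h| <= eps, |Lambda h| <= eta}, where P is the
   projector onto the orthogonal complement of V, since the data 0 arise from
   both h and - h.  It remains to bound every error of [Gamma \o Delta^sigma]
   by r.

   As [Lambda Lambda^* = Id], the regularizer of y is
   v + t Lambda^* (y - Lambda v), where v in V is the least-squares fit of y and
   only t in (0, 1) depends on sigma.  Consequently the error is A + B, with A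
   orthogonal to B = Lambda^* ((1 - t) n - t e'), where n and e' are the
   components of Lambda (P f) and e orthogonal to Lambda V, and
     |P A|^2 + |n|^2 = |P f|^2,   |Lambda A|^2 + |e'|^2 = |e|^2.
   If range(Gamma^* ) is contained in ker(Lambda), then Gamma B = 0 and h = A
   competes in r.  If Gamma = Id, the squared error is at most
   |A|^2 + max(|n|^2, |e'|^2); when |n| is the larger, moving A along ker(Lambda)
   until |P A|^2 has grown by |n|^2 makes |A|^2 grow at least as much and leaves
   Lambda A unchanged; when |e'| is the larger, one moves A along V instead. *)
Require Import Defs.
From HB Require Import structures.
From mathcomp Require Import all_boot all_order all_algebra.
From mathcomp Require Import sesquilinear.
From mathcomp Require Import all_classical all_reals all_analysis.
From mathcomp Require Import ring lra.

Set Implicit Arguments.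
Unset Strict Implicit.

Import Order.TTheory GRing.Theory Num.Theory.
Import numFieldNormedType.Exports.
Local Open Scope classical_set_scope.
Local Open Scope ring_scope.

(** * Inner product identities and the Cauchy-Schwarz inequality *)

Section inner_product.
Context {R : realType} {H : hilbertType R}.
Implicit Types (x y z : H) (a : R).

Lemma innerC x y : inner x y = inner y x.
Proof. by rewrite [LHS]hermC expr0 mul1r. Qed.

Lemma innerDl x y z : inner (x + y) z = inner x z + inner y z.
Proof. exact: linearDl. Qed.

Lemma innerDr x y z : inner z (x + y) = inner z x + inner z y.
Proof. exact: linearDr. Qed.

Lemma innerNl x z : inner (- x) z = - inner x z.
Proof. exact: linearNl. Qed.

Lemma innerNr x z : inner z (- x) = - inner z x.
Proof. exact: linearNr. Qed.

Lemma innerZl a x z : inner (a *: x) z = a * inner x z.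
Proof. exact: linearZl_LR. Qed.

Lemma innerZr a x z : inner z (a *: x) = a * inner z x.
Proof. by rewrite innerC innerZl innerC. Qed.

Lemma inner0l x : inner 0 x = 0.
Proof. exact: linear0l. Qed.

Lemma inner0r x : inner x 0 = 0.
Proof. exact: linear0r. Qed.

Definition innerE := (innerDl, innerDr, innerNl, innerNr, innerZl, innerZr).

Lemma inner_eq0 x : inner x x = 0 -> x = 0.
Proof. by rewrite -sqr_normE => /eqP; rewrite sqrf_eq0 normr_eq0 => /eqP. Qed.

Lemma inner_ext x y : (forall z, inner x z = inner y z) -> x = y.
Proof. by move=> xy; apply/subr0_eq/inner_eq0; rewrite !innerE !xy; ring. Qed.

Lemma inner_gt0 x : x <> 0 -> 0 < inner x x.
Proof.
move=> x0; rewrite -sqr_normE lt0r sqr_ge0 andbT sqrf_eq0 normr_eq0.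
exact/eqP.
Qed.

Lemma sqr_normD x y : `|x + y| ^+ 2 = `|x| ^+ 2 + 2 * inner x y + `|y| ^+ 2.
Proof. by rewrite !sqr_normE !innerE (innerC y x); ring. Qed.

Lemma sqr_normDZ x y a :
  `|x + a *: y| ^+ 2 = `|x| ^+ 2 + 2 * a * inner x y + a ^+ 2 * `|y| ^+ 2.
Proof. by rewrite !sqr_normE !innerE (innerC y x); ring. Qed.

Lemma sqr_inner_le x y : inner x y ^+ 2 <= `|x| ^+ 2 * `|y| ^+ 2.
Proof.
have [->|/eqP y0] := eqVneq y 0.
  by rewrite inner0r expr0n mulr_ge0 ?sqr_ge0.
have y_gt0 : 0 < `|y| ^+ 2 by rewrite sqr_normE inner_gt0.
rewrite -subr_ge0 -(pmulr_rge0 _ y_gt0).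
have := sqr_ge0 `| (`|y| ^+ 2) *: x + (- inner x y) *: y|.
by rewrite sqr_normDZ sqr_normE !innerE -!sqr_normE; congr (0 <= _); ring.
Qed.

Lemma norm_inner_le x y : `|inner x y| <= `|x| * `|y|.
Proof.
rewrite -ler_sqr ?nnegrE ?mulr_ge0// exprMn real_normK ?num_real//.
exact: sqr_inner_le.
Qed.

End inner_product.

(** * The Riesz representation theorem *)

Section riesz.
Context {R : realType} {H : hilbertType R}.
Context (phi : H -> R) (C : R).
Context (phi_linear : forall a x y, phi (a *: x + y) = a * phi x + phi y).
Context (phi_bounded : forall x, `|phi x| <= C * `|x|).

(** If [r] represents [phi], then [J x] is the square of [|x - r|] minus that of [|r|], so the
    representer is sought as the minimizer of [J]. *)
Let J x := `|x| ^+ 2 - 2 * phi x.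

Let J_has_inf : has_inf (range J).
Proof.
split; first by exists (J 0), 0.
exists (- C ^+ 2) => _ [x _ <-].
have := sqr_ge0 (`|x| - C); have := ler_norm (phi x).
have := phi_bounded x; rewrite /J sqrrB; nra.
Qed.

Let J_ge x : inf (range J) <= J x.
Proof. by apply: ge_inf; [case: J_has_inf|exists x]. Qed.

(** The parallelogram identity at the midpoint, where [J] is still at least its infimum; it makes
    minimizing sequences Cauchy. *)
Let J_close (d e : R) x y : J x <= inf (range J) + d ->
  J y <= inf (range J) + e -> `|x - y| ^+ 2 <= 2 * (d + e).
Proof.
move=> Jx Jy; have := J_ge (2^-1 *: x + (2^-1 *: y + 0)).
have phi0 : phi 0 = 0.
  by have := phi_linear 1 0 0; rewrite scaler0 addr0; lra.
rewrite /J !phi_linear phi0 addr0 !sqr_normE !innerE (innerC y x).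
move: Jx Jy; rewrite /J !sqr_normE; lra.
Qed.

(** On the line through [x] directed by [h], [J] is a quadratic that never drops below [J x - d], so
    a discriminant is nonpositive. *)
Let J_critical (d : R) x h : 0 <= d -> J x <= inf (range J) + d ->
  (inner x h - phi h) ^+ 2 <= d * `|h| ^+ 2.
Proof.
move=> d0 Jx; set s := inner x h - phi h; set n := `|h| ^+ 2.
have Jt t : 0 <= d + 2 * t * s + t ^+ 2 * n.
  have := J_ge (t *: h + x); rewrite /J phi_linear [t *: h + x]addrC sqr_normDZ.
  by move: Jx; rewrite /J /s /n; lra.
have n0 : 0 <= n by exact: sqr_ge0.
have [n_eq0|n_neq0] := eqVneq n 0.
  have [->|s0] := eqVneq s 0; first by rewrite expr0n mulr_ge0.
  have := Jt (- (d + 1) / (2 * s)); rewrite n_eq0 mulr0 addr0.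
  by rewrite [X in 0 <= X](_ : _ = -1); [lra|field].
have n_gt0 : 0 < n by rewrite lt0r n_neq0.
have := Jt (- s / n); rewrite -(pmulr_rge0 _ n_gt0).
by rewrite [X in 0 <= X](_ : _ = d * n - s ^+ 2); [lra|field].
Qed.

Lemma riesz : exists x, forall h, phi h = inner h x.
Proof.
pose d (n : nat) : R := n.+1%:R^-1.
have d_gt0 n : 0 < d n by rewrite invr_gt0.
have /choice[u Ju] n : exists x, J x <= inf (range J) + d n.
  have [_ [x _ <-] Jx] := inf_adherent (d_gt0 n) J_has_inf.
  by exists x; exact: ltW.
have d_cvg e : 0 < e -> \forall n \near \oo, d n < e.
  move=> e0; have := @cvg_harmonic R => /cvgrPdist_lt /(_ _ e0).
  by apply: filterS => n; rewrite sub0r normrN ger0_norm// ltW.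
have u_cauchy : cauchy (u @ \oo).
  apply/cauchy_ballP => e e0; rewrite near_map2.
  have e40 : 0 < e ^+ 2 / 4 by rewrite divr_gt0// exprn_gt0.
  have := d_cvg _ e40 => - [N _ dN].
  exists ([set n | (N <= n)%N], [set n | (N <= n)%N]) => /=.
    by split; exists N.
  move=> [n k] [/= /dN/= dn /dN/= dk].
  rewrite -ball_normE /ball_ /= -ltr_sqr ?nnegrE// ?ltW//.
  by apply: (le_lt_trans (J_close (Ju n) (Ju k))); lra.
have /cvg_ex[x ux] : cvg (u @ \oo) by exact: cauchy_cvg.
exists x => h; apply/eqP; rewrite -subr_eq0 -normr_le0.
apply/ler_addgt0Pl => e e0; rewrite addr0.
have h1_gt0 : 0 < `|h| + 1 by rewrite ltr_wpDl.
(* Two error terms of at most [r * |h|] add up to at most [e]; the [+ 1] covers [h = 0]. *)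
pose r := e / 2 / (`|h| + 1).
have r0 : 0 < r by rewrite !divr_gt0.
have r20 : 0 < r ^+ 2 by rewrite exprn_gt0.
have /cvgrPdist_lt /(_ _ r0) ux_lt := ux.
have [n [dn un]] := filter_ex (filterI (d_cvg _ r20) ux_lt).
rewrite (_ : phi h - _ = - (inner (x - u n) h + (inner (u n) h - phi h))); last first.
  by rewrite !innerE (innerC h); ring.
rewrite normrN; apply: (le_trans (ler_normD _ _)).
have h1 : `|inner (x - u n) h| <= r * `|h|.
  by apply: (le_trans (norm_inner_le _ _)); rewrite ler_wpM2r// ltW.
have h2 : `|inner (u n) h - phi h| <= r * `|h|.
  have rh_ge0 : 0 <= r * `|h| by rewrite mulr_ge0// ltW.
  rewrite -ler_sqr ?nnegrE// exprMn real_normK ?num_real//.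
  apply: (le_trans (J_critical _ (ltW (d_gt0 n)) (Ju n))).
  by rewrite ler_wpM2r ?sqr_ge0// ltW.
apply: (le_trans (lerD h1 h2)); rewrite [leRHS](_ : _ = 2 * r * (`|h| + 1)).
  by have := ltW r0; nra.
by rewrite /r; field; rewrite gt_eqF.
Qed.

End riesz.

(** The product of the two roots is [- c / p <= 0], so one of them has a sign compatible with that
    of [r]. *)
Lemma quadratic_signed_root (R : realType) (p q r c : R) : 0 < p -> 0 <= c ->
  exists t, p * t ^+ 2 + 2 * q * t = c /\ 0 <= t * r.
Proof.
move=> p0 c0; set s := Num.sqrt (q ^+ 2 + p * c).
have s2 : s ^+ 2 = q ^+ 2 + p * c.
  by rewrite sqr_sqrtr ?addr_ge0 ?sqr_ge0 ?mulr_ge0 ?(ltW p0).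
have qs : `|q| <= s.
  rewrite -ler_sqr ?nnegrE ?sqrtr_ge0// s2 real_normK ?num_real//.
  by rewrite lerDl mulr_ge0// ltW.
have root t : t ^+ 2 = s ^+ 2 ->
    p * ((t - q) / p) ^+ 2 + 2 * q * ((t - q) / p) = c.
  move=> t2; rewrite [LHS](_ : _ = (t ^+ 2 - q ^+ 2) / p).
    by rewrite t2 s2; field; rewrite gt_eqF.
  by field; rewrite gt_eqF.
have [r0|r0] := leP 0 r.
  exists ((s - q) / p); rewrite root// !mulr_ge0// ?invr_ge0 ?(ltW p0)// subr_ge0.
  by rewrite (le_trans (ler_norm _)).
exists ((- s - q) / p); rewrite root ?sqrrN// mulr_le0// ?(ltW r0)//.
rewrite mulr_le0_ge0// ?invr_ge0 ?(ltW p0)//.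
by have := ler_norm (- q); rewrite normrN; lra.
Qed.

(** * Subspaces, orthogonal splittings and the projector *)

Section orthogonal_decomposition.
Context {R : realType} {H : hilbertType R}.

Definition linear_subspace (V : set H) :=
  V 0 /\ forall a u v, V u -> V v -> V (a *: u + v).

Lemma subspaceD V u v : linear_subspace V -> V u -> V v -> V (u + v).
Proof. by move=> [_ VD] Vu Vv; rewrite -[u]scale1r; exact: VD. Qed.

Lemma subspaceZ V a u : linear_subspace V -> V u -> V (a *: u).
Proof. by move=> [V0 VD] Vu; rewrite -[a *: u]addr0; exact: VD. Qed.

Lemma subspaceB V u v : linear_subspace V -> V u -> V v -> V (u - v).
Proof.
move=> sV Vu Vv; apply: (subspaceD sV Vu).
by rewrite -scaleN1r; exact: subspaceZ.
Qed.

Lemma subspace_orthocompl V : linear_subspace (orthocompl V).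
Proof.
split=> [v _|a u v Vu Vv w Vw]; first by rewrite inner0l.
by rewrite !innerE Vu// Vv// mulr0 addr0.
Qed.

(* Induction on the number of coordinates of [L] that may be nonzero on the
   subspace: one more coordinate adds at most one dimension. *)
Lemma orthogonal_decomposition m (L : {linear H -> euclidean R m}) V :
  linear_subspace V -> (forall v, V v -> L v = 0 -> v = 0) ->
  forall f, exists v, V v /\ orthocompl V (f - v).
Proof.
move=> sV injL.
pose W (k : nat) := [set v | V v /\ forall i : 'I_m, (k <= i)%N -> L v 0 i = 0].
have L_coord a u v i : L (a *: u + v) 0 i = a * L u 0 i + L v 0 i.
  by rewrite linearP !mxE.
have sW k : linear_subspace (W k).
  split; first by split=> [|i _]; [case: sV|rewrite linear0 mxE].
  move=> a u v [Vu Lu] [Vv Lv]; split=> [|i ki]; first by case: sV => _; exact.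
  by rewrite L_coord Lu// Lv// mulr0 addr0.
(* [W m] is [V], while [W 0] is trivial because [L] is injective on [V]. *)
suff decW k f : exists v, W k v /\ orthocompl (W k) (f - v).
  move=> f; have [v [[Vv _] fv]] := decW m f; exists v; split=> // w Vw.
  by apply: fv; split=> // i; rewrite leqNgt ltn_ord.
elim: k f => [|k IHk] f.
  exists 0; split; first by case: (sW 0%N).
  move=> w [Vw Lw]; have -> : w = 0.
    by apply: injL => //; apply/rowP => i; rewrite Lw// mxE.
  by rewrite inner0r.
have [WS|] := pselect (forall x, W k.+1 x -> W k x).
  have [v [Wv fv]] := IHk f; exists v; split=> [|w /WS]; last exact: fv.
  by case: Wv => Vv Lv; split=> // i /ltnW; exact: Lv.
move=> /existsNP[x /not_implyP[[Vx Lx] nWx]].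
have [km|km] := ltnP k m; last first.
  by case: nWx; split=> // i; rewrite leqNgt (leq_trans (ltn_ord i) km).
pose j := Ordinal km.
have xj0 : L x 0 j != 0.
  apply/eqP => xj; apply: nWx; split=> // i.
  rewrite leq_eqVlt => /predU1P[ki|]; last exact: Lx.
  by rewrite (_ : i = j)//; exact: val_inj.
have [x0 [[Vx0 Lx0] xx0]] := IHk x.
pose z := x - x0.
have Wz : W k.+1 z.
  split; first exact: subspaceB.
  move=> i ki; rewrite /z linearB !mxE Lx// Lx0 ?subr0// ltnW//.
have zj : L z 0 j = L x 0 j by rewrite /z linearB !mxE Lx0// subr0.
have z0 : z <> 0 by move=> z0; move: xj0; rewrite -zj z0 linear0 mxE eqxx.
have [f0 [[Vf0 Lf0] ff0]] := IHk f.
have Wkz : orthocompl (W k) z := xx0; clearbody z.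
pose b := inner f z / inner z z.
exists (b *: z + f0); split.
  case: (sW k.+1) => _; apply=> //; split=> // i ki.
  by apply: Lf0; exact: ltnW.
move=> w [Vw Lw]; pose a := L w 0 j / L z 0 j.
have Ww' : W k (w - a *: z).
  split; first by apply: subspaceB => //; apply: subspaceZ => //; case: Wz.
  move=> i; rewrite leq_eqVlt => /predU1P[ki|ki].
    rewrite (_ : i = j); last exact: val_inj.
    by rewrite addrC -scaleNr L_coord /a zj; field.
  by rewrite addrC -scaleNr L_coord Lw//; case: Wz => _ ->//; rewrite mulr0 addr0.
have zw' : inner z (w - a *: z) = 0 by exact: Wkz.
have f0z : inner z f0 = 0 by apply: Wkz.
have ff0w' := ff0 _ Ww'; have zz0 := inner_gt0 z0.
rewrite -(subrK (a *: z) w); move: (w - a *: z) zw' ff0w' => w' zw'.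
rewrite !innerE zw' (innerC f0 z) f0z => ff0w'.
rewrite [LHS](_ : _ = inner f w' - inner f0 w'); first by lra.
by rewrite /b; field; exact: lt0r_neq0.
Qed.

(** Resolves the [xget] in [orthoproj]: another candidate [p] would make [p - g] orthogonal to
    itself. *)
Lemma orthoproj_compl V v g : linear_subspace V -> V v -> orthocompl V g ->
  orthoproj (orthocompl V) (v + g) = g.
Proof.
move=> sV Vv Vg; apply: xget_unique.
  by split=> // w Vw; rewrite addrK innerC; exact: Vw.
move=> p [Vp] /(_ (p - g)) vgp.
have Vpg : orthocompl V (p - g).
  by exact: (subspaceB (subspace_orthocompl V)).
apply/subr0_eq/inner_eq0; have := vgp Vpg; have := Vpg _ Vv.
rewrite (_ : v + g - p = v - (p - g)); last by rewrite opprB addrA.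
by rewrite innerC !innerE; lra.
Qed.

End orthogonal_decomposition.

(** * Adjoint vectors and growth of norms along a line *)

Lemma adjointP (R : realType) (F G : hilbertType R) (Gamma : {linear F -> G}) :
  bounded_near Gamma (nbhs 0) ->
  forall f y, inner (Gamma f) y = inner f (adjoint Gamma y).
Proof.
move=> /linear_boundedP/pinfty_ex_gt0[M M0 GammaM] f y.
rewrite /adjoint; case: xgetP => [x _ /(_ f)//|noadj].
have [||x yx] := @riesz _ _ (fun f => inner (Gamma f) y) (M * `|y|).
- by move=> a u v /=; rewrite linearP !innerE.
- move=> u; apply: (le_trans (norm_inner_le _ _)).
  by rewrite mulrAC ler_wpM2r.
- by case: (noadj x).
Qed.

(* If no adjoint vector existed at [y], then [adjoint Lambda y] would be the
   junk value [0], whence [y = 0], for which [0] is an adjoint vector. *)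
Lemma right_inverse_adjointP (R : realType) (F G : hilbertType R)
    (Lambda : {linear F -> G}) : Lambda \o adjoint Lambda = id ->
  forall f y, inner (Lambda f) y = inner f (adjoint Lambda y).
Proof.
move=> Lambda_adj f y; have := congr1 (@^~ y) Lambda_adj.
rewrite /= /adjoint; case: xgetP => [x _ /(_ f)//|_]; rewrite linear0 => <-.
by rewrite !inner0r.
Qed.

(* Moving along [u] in a suitable direction, the growth of [`|x|] is at least
   that of [`|T x|] because [`|x| ^+ 2 - `|T x| ^+ 2] is a convex quadratic
   function of the step. *)
Lemma contraction_step (R : realType) (H K : hilbertType R) (x u : H)
    (Tx Tu : K) (c : R) : Tu <> 0 -> `|Tu| <= `|u| -> 0 <= c ->
  exists t, `|Tx + t *: Tu| ^+ 2 = `|Tx| ^+ 2 + c /\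
    `|x| ^+ 2 + c <= `|x + t *: u| ^+ 2.
Proof.
move=> Tu0 Tu_le c0.
have Tu_gt0 : 0 < `|Tu| ^+ 2 by rewrite sqr_normE inner_gt0.
have [t [tc tr]] :=
  quadratic_signed_root (inner Tx Tu) (inner x u - inner Tx Tu) Tu_gt0 c0.
exists t; rewrite !sqr_normDZ; split; first by rewrite -tc; ring.
have Tu_le2 : `|Tu| ^+ 2 <= `|u| ^+ 2 by rewrite ler_sqr ?nnegrE.
have := sqr_ge0 t; rewrite -tc; nra.
Qed.

(** * Linearity of the projector and lower bounds on the worst-case error *)

Section worst_case_error.
Context {R : realType} {F : hilbertType R} {m : nat}.
Context (Lambda : {linear F -> euclidean R m}) (V : set F) (eps eta : R).
Context (V_subspace : linear_subspace V).
Context (V_inj : forall v, V v -> Lambda v = 0 -> v = 0).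
Local Notation P := (orthoproj (orthocompl V)).

Lemma orthoproj_compl_sub f :
  V (f - P f) /\ orthocompl V (P f).
Proof.
have [v [Vv Vfv]] := orthogonal_decomposition V_subspace V_inj f.
have -> : P f = f - v.
  by rewrite -(orthoproj_compl V_subspace Vv Vfv) addrC subrK.
by rewrite subKr.
Qed.

Lemma orthoproj_compl_linear a f g : P (a *: f + g) = a *: P f + P g.
Proof.
have [[Vf Vf'] [Vg Vg']] := (orthoproj_compl_sub f, orthoproj_compl_sub g).
have [_ VD] := V_subspace; have [_ VD'] := subspace_orthocompl V.
rewrite -(orthoproj_compl V_subspace (VD a _ _ Vf Vg) (VD' a _ _ Vf' Vg')).
by rewrite addrACA -scalerDr !subrK.
Qed.

Lemma orthoproj_complN f : P (- f) = - P f.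
Proof.
have P0 : P 0 = 0.
  have := orthoproj_compl_linear 1 0 0; rewrite !scale1r addr0 => PP.
  by apply: (addrI (P 0)); rewrite addr0.
by rewrite -[- f]addr0 -scaleN1r orthoproj_compl_linear P0 addr0 scaleN1r.
Qed.

Lemma orthoproj_compl_le f : `|P f| <= `|f|.
Proof.
rewrite -ler_sqr ?nnegrE// -[f in leRHS](subrK (P f)) sqr_normD.
have [Vf Vf'] := orthoproj_compl_sub f.
by rewrite innerC Vf'// mulr0 addr0 lerDr sqr_ge0.
Qed.

(* The data [0] are compatible with both [h] and [- h]. *)
Lemma gwce_ge (G : hilbertType R) (Gamma : {linear F -> G})
    (Delta : euclidean R m -> G) h : `|P h| <= eps ->
  `|Lambda h| <= eta -> (`|Gamma h|%:E <= gwce Lambda V eps eta Gamma Delta)%E.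
Proof.
move=> h_eps h_eta.
have gwce_sup k : `|P k| <= eps -> `|Lambda k| <= eta ->
    (`|Gamma k - Delta 0|%:E <= gwce Lambda V eps eta Gamma Delta)%E.
  move=> k_eps k_eta; apply: ereal_sup_ubound.
  by exists (k, - Lambda k) => /=; [rewrite normrN|rewrite subrr].
have := gwce_sup h h_eps h_eta.
have := gwce_sup (- h); rewrite orthoproj_complN !linearN !normrN.
move=> /(_ h_eps h_eta).
case: (gwce _ _ _ _ _ _) => [r| |]; rewrite ?leey// !lee_fin.
set a := Gamma h; set d := Delta 0 => ad1 ad2.
have : `|(a - d) - (- a - d)| <= `|a - d| + `|- a - d| by exact: ler_normB.
rewrite (_ : a - d - (- a - d) = 2 *: a); last first.
  by rewrite opprB opprK addrA subrK -[2]/(1 + 1) scalerDl scale1r.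
by rewrite normrZ ger0_norm//; lra.
Qed.

(** Reduces optimality to finding, for each admissible pair, a competitor [h] whose image dominates
    the error; [gwce_ge] then applies to every rival map. *)
Lemma gwce_optimal (G : hilbertType R) (Gamma : {linear F -> G})
    (Delta : euclidean R m -> G) :
  (forall f e, `|P f| <= eps -> `|e| <= eta ->
    exists h, [/\ `|P h| <= eps, `|Lambda h| <= eta &
      `|Gamma f - Delta (Lambda f + e)| <= `|Gamma h|]) ->
  gwce Lambda V eps eta Gamma Delta =
  ereal_inf (range (gwce Lambda V eps eta Gamma)).
Proof.
move=> Delta_le; apply/eqP; rewrite eq_le; apply/andP; split; last first.
  by apply: ereal_inf_lbound; exists Delta.
apply: le_ereal_inf_tmp => _ [Delta' _ <-].
apply: ge_ereal_sup => _ [[f e] /= [fe ee] <-].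
have [h [h_eps h_eta h_ge]] := Delta_le f e fe ee.
by apply: le_trans (gwce_ge Gamma Delta' h_eps h_eta); rewrite lee_fin.
Qed.

End worst_case_error.

(** * The regularizer in closed form and its error *)

Section regularization.
Context {R : realType} {F : hilbertType R} {m : nat}.
Context (Lambda : {linear F -> euclidean R m}) (V : set F) (eps eta : R).
Context (V_subspace : linear_subspace V).
Context (V_inj : forall v, V v -> Lambda v = 0 -> v = 0).
Context (eps_gt0 : 0 < eps) (eta_gt0 : 0 < eta).
Context (Lambda_adj : Lambda \o adjoint Lambda = id).
Local Notation P := (orthoproj (orthocompl V)).
Local Notation LambdaT := (adjoint Lambda).

Let LambdaK n : Lambda (LambdaT n) = n.
Proof. by have := congr1 (@^~ n) Lambda_adj. Qed.

Let LambdaP f n : inner (Lambda f) n = inner f (LambdaT n).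
Proof. exact: right_inverse_adjointP. Qed.

(** In [J (f0 + h)] the cross terms cancel because [a * t = b * (1 - t)]. What is added to [J f0] is
    nonnegative and vanishes only for [h] in [V] and in the kernel of [Lambda], hence only for
    [h = 0]. *)
Lemma regularizationE (sigma : R) (y : euclidean R m) v :
  0 < sigma < 1 -> V v -> orthocompl (Lambda @` V) (y - Lambda v) ->
  let a := (1 - sigma) / eps ^+ 2 in let b := sigma / eta ^+ 2 in
  regularization Lambda V eps eta sigma y =
  v + (b / (a + b)) *: LambdaT (y - Lambda v).
Proof.
move=> /andP[s0 s1] Vv; set n := y - Lambda v => Vn a b.
have a0 : 0 < a by rewrite divr_gt0 ?exprn_gt0// subr_gt0.
have b0 : 0 < b by rewrite divr_gt0 ?exprn_gt0.
set t := b / (a + b); set f0 := v + _.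
pose J f := a * `|P f| ^+ 2 + b * `|y - Lambda f| ^+ 2.
have VT : orthocompl V (LambdaT n).
  by move=> w Vw; rewrite innerC -LambdaP innerC; apply: Vn; exists w.
have sV' := subspace_orthocompl V.
have Pf0 : P f0 = t *: LambdaT n.
  by rewrite orthoproj_compl//; exact: (subspaceZ _ sV' VT).
have Jh h w : V w -> orthocompl V (h - w) ->
    J (f0 + h) = J f0 + a * `|h - w| ^+ 2 + b * `|Lambda h| ^+ 2.
  move=> Vw Vhw; rewrite /J Pf0.
  have -> : P (f0 + h) = t *: LambdaT n + 1 *: (h - w).
    rewrite -[h in LHS](subrK w) [h - w + w]addrC /f0 addrACA scale1r.
    rewrite orthoproj_compl//.
      exact: subspaceD.
    exact: (subspaceD sV' (subspaceZ _ sV' VT) Vhw).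
  have Lf0 : y - Lambda f0 = (1 - t) *: n.
    by rewrite /f0 linearD linearZ /= LambdaK opprD addrA -/n scalerBl scale1r.
  have -> : y - Lambda (f0 + h) = (1 - t) *: n + (-1) *: Lambda h.
    by rewrite linearD opprD addrA Lf0 scaleN1r.
  rewrite Lf0 !sqr_normDZ !innerZl.
  have -> : inner n (Lambda h) = inner (LambdaT n) (h - w).
    rewrite innerDr innerNr (VT _ Vw) subr0 innerC LambdaP; exact: innerC.
  have tab : a * t = b * (1 - t) by rewrite /t; field; rewrite gt_eqF// addr_gt0.
  set i := inner _ _; have : a * t * i = b * (1 - t) * i by rewrite tab.
  by lra.
apply: xget_unique => [z|z /(_ f0)]; rewrite -/(J f0) -/(J z).
  rewrite -[z](subrK f0) [z - f0 + f0]addrC.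
  have [w [Vw Vzw]] := orthogonal_decomposition V_subspace V_inj (z - f0).
  by rewrite (Jh _ _ Vw Vzw) -addrA lerDl addr_ge0// mulr_ge0 ?sqr_ge0// ltW.
have [w [Vw Vzw]] := orthogonal_decomposition V_subspace V_inj (z - f0).
rewrite -[z in J z](subrK f0) [z - f0 + f0]addrC (Jh _ _ Vw Vzw).
set g := z - f0 - w; set p := Lambda _ => Jle.
have ag : 0 <= a * `|g| ^+ 2 by rewrite mulr_ge0 ?sqr_ge0// ltW.
have bp : 0 <= b * `|p| ^+ 2 by rewrite mulr_ge0 ?sqr_ge0// ltW.
have /eqP : a * `|g| ^+ 2 = 0 by lra.
rewrite mulf_eq0 gt_eqF//= sqrf_eq0 normr_eq0 subr_eq0 => /eqP zw.
have /eqP : b * `|p| ^+ 2 = 0 by lra.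
rewrite mulf_eq0 gt_eqF//= sqrf_eq0 normr_eq0 /p => /eqP Lz.
by apply/subr0_eq/V_inj => //; rewrite zw.
Qed.

(* The component [n] of [Lambda P f] orthogonal to [Lambda V], and the
   component [e'] of the noise orthogonal to [Lambda V], are the only parts of
   the error that depend on [sigma]. *)
Lemma regularization_error (sigma : R) f (e : euclidean R m) : 0 < sigma < 1 ->
  exists A n e' t, [/\ 0 <= t <= 1,
    f - regularization Lambda V eps eta sigma (Lambda f + e) =
      A + LambdaT ((1 - t) *: n - t *: e'),
    `|P A| ^+ 2 + `|n| ^+ 2 = `|P f| ^+ 2,
    `|Lambda A| ^+ 2 + `|e'| ^+ 2 = `|e| ^+ 2 &
    inner A (LambdaT ((1 - t) *: n - t *: e')) = 0].
Proof.
move=> sigma01; have sV' := subspace_orthocompl V.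
have sLV : linear_subspace (Lambda @` V).
  case: V_subspace => V0 VD; split; first by exists 0; rewrite ?linear0.
  by move=> a _ _ [u Vu <-] [v Vv <-]; exists (a *: u + v);
    rewrite ?linearP//; exact: VD.
(* With the identity as [L], the splitting lemma applies in the data space. *)
have decLV := @orthogonal_decomposition _ _ m idfun _ sLV (fun _ _ => id).
have [q [Vq]] := orthogonal_decomposition V_subspace V_inj f.
set g := f - q => Vg.
have [_ [[v1 Vv1 <-]]] := decLV (Lambda g); set n := Lambda g - _ => LVn.
have [_ [[v2 Vv2 <-]]] := decLV e; set e' := e - _ => LVe.
have VT k : orthocompl (Lambda @` V) k -> orthocompl V (LambdaT k).
  by move=> Vk w Vw; rewrite innerC -LambdaP innerC; apply: Vk; exists w.
(* The least-squares fit of the data: its residual [n + e'] is orthogonal to the image of [V]. *)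
have Vv : V (q + v1 + v2) by do 2!apply: subspaceD => //.
have yv : Lambda f + e - Lambda (q + v1 + v2) = n + e'.
  apply: inner_ext => h.
  by rewrite /n /e' /g linearB !linearD /= !innerE; ring.
(* Removing [LambdaT n] leaves [Lambda v1] as the image of [g - LambdaT n], which [- v1] cancels, so
   that [Lambda A = - Lambda v2]. *)
set A := - (v1 + v2) + (g - LambdaT n).
pose a := (1 - sigma) / eps ^+ 2; pose b := sigma / eta ^+ 2.
have [s0 s1] := andP sigma01.
have a0 : 0 < a by rewrite divr_gt0 ?exprn_gt0// subr_gt0.
have b0 : 0 < b by rewrite divr_gt0 ?exprn_gt0.
have ab0 : 0 < a + b by rewrite addr_gt0.
(* [adjoint] is a chosen value without a linear structure, so its linearity is used only when tested
   against a vector. *)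
have LTl k1 k2 h :
    inner (LambdaT (k1 + k2)) h = inner (LambdaT k1) h + inner (LambdaT k2) h.
  by rewrite !(innerC _ h) -!LambdaP innerDr.
have LTZ r k h : inner (LambdaT (r *: k)) h = r * inner (LambdaT k) h.
  by rewrite !(innerC _ h) -!LambdaP innerZr.
have LTN k h : inner (LambdaT (- k)) h = - inner (LambdaT k) h.
  by rewrite !(innerC _ h) -!LambdaP innerNr.
have LA : Lambda A = - Lambda v2.
  apply: inner_ext => h; rewrite /A /n linearD linearN linearB LambdaK linearD.
  by rewrite /= !innerE; ring.
have Lv1n : inner (Lambda v1) n = 0 by rewrite innerC; apply: LVn; exists v1.
have Lv2n : inner (Lambda v2) n = 0 by rewrite innerC; apply: LVn; exists v2.
have Lv2e : inner (Lambda v2) e' = 0 by rewrite innerC; apply: LVe; exists v2.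
exists A, n, e', (b / (a + b)); split.
- by rewrite divr_ge0 ?(ltW b0) ?(ltW ab0)//= ler_pdivrMr// mul1r lerDr ltW.
- rewrite (@regularizationE sigma (Lambda f + e) (q + v1 + v2))// yv; last first.
    exact: (subspaceD (subspace_orthocompl _) LVn LVe).
  rewrite -/a -/b; set t := b / _; apply: inner_ext => h.
  by rewrite /A /g !(innerE, LTl, LTZ, LTN); ring.
- have -> : P f = g by rewrite -(orthoproj_compl V_subspace Vq Vg) addrC subrK.
  rewrite orthoproj_compl//; last 2 first.
  + by rewrite -scaleN1r; apply: subspaceZ => //; exact: subspaceD.
  + exact: (subspaceB sV' Vg (VT _ LVn)).
  rewrite -scaleN1r sqr_normDZ -LambdaP.
  have -> : `|LambdaT n| ^+ 2 = `|n| ^+ 2.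
    by rewrite sqr_normE -LambdaP LambdaK sqr_normE.
  have -> : inner (Lambda g) n = `|n| ^+ 2.
    by rewrite -[Lambda g](subrK (Lambda v1)) innerDl Lv1n addr0 sqr_normE.
  by ring.
- rewrite LA normrN -[e in RHS](subrK (Lambda v2)) -/e' [RHS]sqr_normD.
  rewrite innerC Lv2e; ring.
- rewrite -LambdaP LA innerNl innerDr innerNr !innerZr Lv2n Lv2e; ring.
Qed.

End regularization.

(** * Optimality of all regularization maps *)

Lemma contraction_of_right_inverse (R : realType) (F G : hilbertType R)
    (Lambda : {linear F -> G}) : Lambda \o adjoint Lambda = id ->
  forall f, `|Lambda f| <= `|f|.
Proof.
move=> Lambda_adj f; have LambdaP := right_inverse_adjointP Lambda_adj.
rewrite -ler_sqr ?nnegrE//.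
(* By Pythagoras this square equals that of [|f|] minus that of [|Lambda f|]. *)
have := sqr_ge0 `|f - adjoint Lambda (Lambda f)|.
rewrite -scaleN1r sqr_normDZ -LambdaP.
have -> : `|adjoint Lambda (Lambda f)| ^+ 2 = `|Lambda f| ^+ 2.
  rewrite !sqr_normE -LambdaP.
  by have := congr1 (@^~ (Lambda f)) Lambda_adj => /= ->.
by rewrite -sqr_normE; lra.
Qed.

Theorem theorem6 (R : realType) (F : hilbertType R) (m : nat)
    (Lambda : {linear F -> euclidean R m}) (V : set F) (eps eta : R)
    (Lambda_bounded : bounded_near Lambda (nbhs 0))
    (V_subspace : submod_closed [in V])
    (V_ker : V `&` Lambda @^-1` [set 0] = [set 0])
    (eps_gt0 : 0 < eps) (eta_gt0 : 0 < eta)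
    (Lambda_orthonormal : Lambda \o adjoint Lambda = id) :
  (forall (G : hilbertType R) (Gamma : {linear F -> G}),
      bounded_near Gamma (nbhs 0) ->
      range (adjoint Gamma) `<=` Lambda @^-1` [set 0] ->
      forall sigma : R, 0 < sigma < 1 ->
        gwce Lambda V eps eta Gamma
          (Gamma \o regularization Lambda V eps eta sigma) =
        ereal_inf (range (gwce Lambda V eps eta Gamma)))
  /\
  (((0 < m)%N -> V <> [set 0]) ->
   (V <> setT -> Lambda @^-1` [set 0] <> [set 0]) ->
      forall sigma : R, 0 < sigma < 1 ->
        gwce Lambda V eps eta (@idfun F)
          (@idfun F \o regularization Lambda V eps eta sigma) =
        ereal_inf (range (gwce Lambda V eps eta (@idfun F)))).
Proof.
have sV : linear_subspace V.
  case: V_subspace => V0 VD; split; first by rewrite inE in V0.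
  by move=> a u v Vu Vv; have := VD a u v; rewrite !inE; exact.
have V_inj v : V v -> Lambda v = 0 -> v = 0.
  by move=> Vv Lv; have : (V `&` Lambda @^-1` [set 0]) v by []; rewrite V_ker.
have LambdaP := right_inverse_adjointP Lambda_orthonormal.
have err := regularization_error sV V_inj eps_gt0 eta_gt0 Lambda_orthonormal.
have le_sqr (x y z w : R) : 0 <= x -> 0 <= y -> 0 <= z ->
    x ^+ 2 + y ^+ 2 = z ^+ 2 -> z <= w -> x <= w.
  move=> x0 y0 z0 xyz zw; apply: le_trans zw.
  by rewrite -ler_sqr ?nnegrE// -xyz lerDl sqr_ge0.
split=> [G Gamma Gamma_bounded Gamma_ker|V_neq0 ker_neq0] sigma sigma01.
  apply: (gwce_optimal sV V_inj) => f e f_eps e_eta.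
  have [A [n [e' [t [_ errE PA LA _]]]]] := err sigma f e sigma01.
  exists A; split; [exact: le_sqr PA f_eps|exact: le_sqr LA e_eta|].
  rewrite /= -linearB errE linearD /= (_ : Gamma (adjoint Lambda _) = 0) ?addr0//.
  apply: inner_ext => y; rewrite (adjointP Gamma_bounded) innerC -LambdaP inner0l.
  have -> : Lambda (adjoint Gamma y) = 0 by apply: Gamma_ker; exists y.
  exact: inner0l.
apply: (gwce_optimal sV V_inj) => f e f_eps e_eta.
have [A [n [e' [t [/andP[t0 t1] errE PA LA AB]]]]] := err sigma f e sigma01.
have PA_eps : `|orthoproj (orthocompl V) A| <= eps by exact: le_sqr PA f_eps.
have LA_eta : `|Lambda A| <= eta by exact: le_sqr LA e_eta.
set B := adjoint Lambda _ in errE.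
(* The adjoint of [Lambda] is isometric, and a convex combination of [|n|] and [|e'|] is at most
   [c]. *)
have err_le c : `|n| <= c -> `|e'| <= c ->
    `|f - regularization Lambda V eps eta sigma (Lambda f + e)| ^+ 2 <=
    `|A| ^+ 2 + c ^+ 2.
  move=> nc ec; rewrite errE sqr_normD AB mulr0 addr0 lerD2l.
  rewrite sqr_normE /B -LambdaP.
  have := congr1 (@^~ ((1 - t) *: n - t *: e')) Lambda_orthonormal => /= ->.
  have c0 : 0 <= c by exact: le_trans nc.
  rewrite -sqr_normE ler_sqr ?nnegrE//.
  apply: (le_trans (ler_normB _ _)); rewrite !normrZ !ger0_norm ?subr_ge0//.
  rewrite [leRHS](_ : _ = (1 - t) * c + t * c); last by ring.
  by apply: lerD; rewrite ler_wpM2l ?subr_ge0.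
rewrite /=.
have [en|ne] := leP `|e'| `|n|.
  have [n0|n0] := eqVneq n 0.
    exists A; split=> //; rewrite -ler_sqr ?nnegrE//.
    by apply: (le_trans (err_le `|n| _ _)); rewrite // n0 normr0 expr0n addr0.
  (* [V = setT] would give [P f = 0] and then [n = 0]; its exclusion yields a direction in the
     kernel of [Lambda]. *)
  have VT : V <> setT.
    move=> VT; have [_ /(_ _ _)/inner_eq0 Pf] := orthoproj_compl_sub sV V_inj f.
    move: PA; rewrite Pf ?VT// normr0 [in RHS]expr0n => PA0.
    move/eqP: PA0; rewrite paddr_eq0 ?sqr_ge0// => /andP[_].
    by rewrite sqrf_eq0 normr_eq0 (negPf n0).
  have [k [Lk k0]] : exists k, Lambda k = 0 /\ k <> 0.
    apply: contrapT => nok; apply: (ker_neq0 VT); apply/seteqP; split=> k /=.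
      by move=> Lk; apply: contrapT => k0; apply: nok; exists k.
    by move=> ->; rewrite linear0.
  have Pk0 : orthoproj (orthocompl V) k <> 0.
    move=> Pk; have [+ _] := orthoproj_compl_sub sV V_inj k.
    by rewrite Pk subr0 => Vk; apply: k0; exact: V_inj.
  (* The projector is the contraction here: its squared norm grows from that of [P A] to exactly
     that of [P f]. *)
  have [s [Ps As]] := contraction_step A (orthoproj (orthocompl V) A) Pk0
    (orthoproj_compl_le sV V_inj k) (sqr_ge0 `|n|).
  exists (s *: k + A); split.
  - rewrite (orthoproj_compl_linear sV V_inj) addrC -ler_sqr ?nnegrE ?(ltW eps_gt0)//.
    by rewrite Ps PA ler_sqr ?nnegrE ?(ltW eps_gt0).
  - by rewrite linearP Lk scaler0 add0r.
  - rewrite -ler_sqr ?nnegrE// [s *: _ + _]addrC; apply: le_trans As; exact: err_le.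
have [e0|e0] := eqVneq e' 0.
  by move: ne; rewrite e0 normr0 normr_lt0.
(* A nonzero [e'] needs a coordinate, which unlocks the nontriviality of [V]. *)
have m_gt0 : (0 < m)%N.
  rewrite lt0n; apply: contra_neqN e0 => /eqP m0.
  by apply/rowP => -[i im]; exfalso; move: im; rewrite m0.
have [v [Vv v0]] : exists v, V v /\ v <> 0.
  apply: contrapT => nov; apply: (V_neq0 m_gt0); apply/seteqP; split=> v /=.
    by move=> Vv; apply: contrapT => v0; apply: nov; exists v.
  by move=> ->; case: sV.
have Lv0 : Lambda v <> 0 by move=> Lv; apply: v0; exact: V_inj.
(* Now [Lambda] is the contraction, and the squared norm of [Lambda A] grows to exactly that of
   [e]. *)
have [s [Ls As]] := contraction_step A (Lambda A) Lv0
  (contraction_of_right_inverse Lambda_orthonormal v) (sqr_ge0 `|e'|).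
have Pv : orthoproj (orthocompl V) v = 0.
  rewrite -[v]addr0; apply: orthoproj_compl => //.
  by case: (subspace_orthocompl V).
exists (s *: v + A); split.
- by rewrite (orthoproj_compl_linear sV V_inj) Pv scaler0 add0r.
- rewrite linearP addrC -ler_sqr ?nnegrE ?(ltW eta_gt0)//.
  by rewrite Ls LA ler_sqr ?nnegrE ?(ltW eta_gt0).
- rewrite -ler_sqr ?nnegrE// [s *: _ + _]addrC.
  by apply: le_trans As; apply: err_le => //; exact: ltW.
Qed.
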